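(* Fix a server $m$, a nonempty coalition $S\subseteq\mathcal N$ of MDs associated with $m$, and a partition strategy $\{z_{m,n,l}\}_{n\in S,\,l\in\mathcal L}$ with $z_{m,n,l}\in\{0,\dots,K_l\}$. For $V\subseteq\mathcal L$ let $f(V)$ be the coalition utility $$f(V)=\frac{-\alpha\sum_{n\in S}\tau_n(V)+\Xi\sum_{n\in S}(\bar\Upsilon_n-\Upsilon_n)-\Theta}{|S|}$$ obtained when exactly the models in $V$ are deployed on server $m$. Then the model deployment subproblem $$\max_{V\subseteq\mathcal L}\ f(V)\quad\text{subject to}\quad\sum_{l\in V}D_l\le C_m$$ is a submodular maximization problem: $f$ is a submodular set function on $2^{\mathcal L}$, i.e. $f(A\cup\{j\})-f(A)\ge f(B\cup\{j\})-f(B)$ for all $A\subseteq B\subseteq\mathcal L$ and $j\in\mathcal L\setminus B$.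
   Context: Setting (one time slot, time index suppressed). There are edge servers $\mathcal M=\{1,\dots,M\}$, mobile devices (MDs) $\mathcal N=\{1,\dots,N\}$ and DNN models $\mathcal L=\{1,\dots,L\}$. A coalition is the set $S$ of MDs associated with a given server $m$. Model data. Model $l$ has storage size $D_l>0$ and $K_l$ layers. For partition point $z\in\{0,\dots,K_l\}$ the nonnegative data are device-side and edge-side workloads $W_l^{\mathrm{dev}}(z),W_l^{\mathrm{edge}}(z)$, device-side sub-model size $D_l^{\mathrm{dev}}(z)$, intermediate feature size $I_l(z)$ and privacy risk $\phi_l(z)\in[0,1]$. Server and device data. Server $m$ has computation resource $F_m>0$, storage $C_m\ge0$, bandwidth $B_m>0$, transmit power $P_m>0$ and cloud-to-edge rate $R^{c2e}_m>0$. MD $n$ has computation resource $F_n>0$ and transmit power $P_n>0$, requests one model $l_n\in\mathcal L$, and has data size $d_n>0$ and privacy threshold $\bar\Upsilon_n\ge0$. Channel gains are $h^{\mathrm{up}}_{m,n},h^{\mathrm{down}}_{m,n}>0$ and the noise density is $N_0>0$. The previous-slot deployment $x^-_{m,l}\in\{0,1\}$ is given. Constants. $\alpha>0$ is a trade-off parameter, $\Xi\ge0$ is the current accumulated privacy leakage (given), and $\Theta=\frac12\sum_{n=1}^N\bar\Upsilon_n^2$. Delay and privacy loss for $n\in S$. Let $b=B_m/|S|$, $f_{m}=F_m/|S|$, $$R^{\mathrm{up}}_{m,n}=b\log_2\!\Big(1+\tfrac{P_nh^{\mathrm{up}}_{m,n}}{N_0b}\Big),\qquad R^{\mathrm{down}}_{m,n}=b\log_2\!\Big(1+\tfrac{P_mh^{\mathrm{down}}_{m,n}}{N_0b}\Big).$$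 With $l=l_n$, $z=z_{m,n,l}$, and $x_{m,l}=1$ if $l\in V$, $x_{m,l}=0$ otherwise, $$\tau_n(V)=(1-x^-_{m,l})\,x_{m,l}\frac{D_l}{R^{c2e}_m}+\frac{D^{\mathrm{dev}}_l(z)}{R^{\mathrm{down}}_{m,n}}+\max\Big\{\frac{d_nW^{\mathrm{dev}}_l(z)}{F_n},\frac{d_nI_l(z)}{R^{\mathrm{up}}_{m,n}},\frac{d_nW^{\mathrm{edge}}_l(z)}{f_m}\Big\},\qquad \Upsilon_n=d_n\,\phi_l(z).$$ *)

(* Defs.v *)
From mathcomp Require Import all_boot all_order all_algebra.
From mathcomp Require Import reals exp.

Set Implicit Arguments.
Unset Strict Implicit.
Unset Printing Implicit Defensive.

Import Order.TTheory GRing.Theory Num.Theory.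
Local Open Scope ring_scope.

Definition submodular (R : numDomainType) (T : finType) (f : {set T} -> R) :=
  forall (A B : {set T}) (j : T), A \subset B -> j \notin B ->
    f (B :|: [set j]) - f B <= f (A :|: [set j]) - f A.

(* The problem of maximizing [objective V] over the sets V with [feasible V]. *)
Record set_max_problem (R : numDomainType) (T : finType) := SetMaxProblem {
  objective : {set T} -> R;
  feasible : pred {set T} }.

Definition submodular_maximization (R : numDomainType) (T : finType)
    (P : set_max_problem R T) := submodular (objective P).

Definition log2 (R : realType) (x : R) : R := ln x / ln 2.

(* Data of one time slot for M edge servers, N mobile devices and L models.
   A partition point of model l is an element of 'I_(layers l).+1, that is,
   an integer in {0, ..., K_l}. *)
Record edge_system (R : realType) (M N L : nat) := EdgeSystem {
  (* models: K_l, D_l, W^dev_l(z), W^edge_l(z), D^dev_l(z), I_l(z), phi_l(z) *)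
  layers : 'I_L -> nat;
  model_size : 'I_L -> R;
  work_dev : forall l : 'I_L, 'I_(layers l).+1 -> R;
  work_edge : forall l : 'I_L, 'I_(layers l).+1 -> R;
  size_dev : forall l : 'I_L, 'I_(layers l).+1 -> R;
  feature_size : forall l : 'I_L, 'I_(layers l).+1 -> R;
  privacy_risk : forall l : 'I_L, 'I_(layers l).+1 -> R;
  model_size_gt0 : forall l, 0 < model_size l;
  work_dev_ge0 : forall l (z : 'I_(layers l).+1), 0 <= work_dev z;
  work_edge_ge0 : forall l (z : 'I_(layers l).+1), 0 <= work_edge z;
  size_dev_ge0 : forall l (z : 'I_(layers l).+1), 0 <= size_dev z;
  feature_size_ge0 : forall l (z : 'I_(layers l).+1), 0 <= feature_size z;
  privacy_risk_01 : forall l (z : 'I_(layers l).+1), 0 <= privacy_risk z <= 1;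
  (* servers: F_m, C_m, B_m, P_m, R^c2e_m, and the previous-slot x^-_(m,l) *)
  srv_comp : 'I_M -> R;
  srv_storage : 'I_M -> R;
  bandwidth : 'I_M -> R;
  srv_power : 'I_M -> R;
  cloud_rate : 'I_M -> R;
  prev_deployed : 'I_M -> 'I_L -> bool;
  srv_comp_gt0 : forall m, 0 < srv_comp m;
  srv_storage_ge0 : forall m, 0 <= srv_storage m;
  bandwidth_gt0 : forall m, 0 < bandwidth m;
  srv_power_gt0 : forall m, 0 < srv_power m;
  cloud_rate_gt0 : forall m, 0 < cloud_rate m;
  (* devices: F_n, P_n, l_n, d_n, and the privacy threshold *)
  md_comp : 'I_N -> R;
  md_power : 'I_N -> R;
  requested : 'I_N -> 'I_L;
  data_size : 'I_N -> R;
  privacy_threshold : 'I_N -> R;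
  md_comp_gt0 : forall n, 0 < md_comp n;
  md_power_gt0 : forall n, 0 < md_power n;
  data_size_gt0 : forall n, 0 < data_size n;
  privacy_threshold_ge0 : forall n, 0 <= privacy_threshold n;
  (* channels: h^up_(m,n), h^down_(m,n), and the noise density N_0 *)
  gain_up : 'I_M -> 'I_N -> R;
  gain_down : 'I_M -> 'I_N -> R;
  noise : R;
  gain_up_gt0 : forall m n, 0 < gain_up m n;
  gain_down_gt0 : forall m n, 0 < gain_down m n;
  noise_gt0 : 0 < noise }.

Arguments work_dev {R M N L} e l z.
Arguments work_edge {R M N L} e l z.
Arguments size_dev {R M N L} e l z.
Arguments feature_size {R M N L} e l z.
Arguments privacy_risk {R M N L} e l z.

(* For a fixed server, z n l is the partition point of model l on device n.
   The family is total in n; only the devices of the coalition are ever used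
   below. *)
Definition partition_strategy (R : realType) (M N L : nat)
    (E : edge_system R M N L) : Type :=
  forall (n : 'I_N) (l : 'I_L), 'I_(layers E l).+1.

Definition md_bandwidth (R : realType) (M N L : nat) (E : edge_system R M N L)
    (m : 'I_M) (S : {set 'I_N}) : R := bandwidth E m / #|S|%:R.

Definition md_edge_comp (R : realType) (M N L : nat) (E : edge_system R M N L)
    (m : 'I_M) (S : {set 'I_N}) : R := srv_comp E m / #|S|%:R.

Definition rate_up (R : realType) (M N L : nat) (E : edge_system R M N L)
    (m : 'I_M) (S : {set 'I_N}) (n : 'I_N) : R :=
  let b := md_bandwidth E m S in
  b * log2 (1 + md_power E n * gain_up E m n / (noise E * b)).

Definition rate_down (R : realType) (M N L : nat) (E : edge_system R M N L)
    (m : 'I_M) (S : {set 'I_N}) (n : 'I_N) : R :=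
  let b := md_bandwidth E m S in
  b * log2 (1 + srv_power E m * gain_down E m n / (noise E * b)).

(* The booleans x^-_(m,l) and (l \in V) enter the formula as 0 or 1 in R. *)
Definition delay (R : realType) (M N L : nat) (E : edge_system R M N L)
    (m : 'I_M) (S : {set 'I_N}) (z : partition_strategy E)
    (V : {set 'I_L}) (n : 'I_N) : R :=
  let l := requested E n in
  let zn := z n l in
  (1 - (prev_deployed E m l)%:R) * (l \in V)%:R
      * (model_size E l / cloud_rate E m)
  + size_dev E l zn / rate_down E m S n
  + Num.max
      (Num.max (data_size E n * work_dev E l zn / md_comp E n)
               (data_size E n * feature_size E l zn / rate_up E m S n))
      (data_size E n * work_edge E l zn / md_edge_comp E m S).

Definition privacy_loss (R : realType) (M N L : nat) (E : edge_system R M N L)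
    (z : partition_strategy E) (n : 'I_N) : R :=
  let l := requested E n in
  data_size E n * privacy_risk E l (z n l).

Definition Theta (R : realType) (M N L : nat) (E : edge_system R M N L) : R :=
  2^-1 * \sum_(n < N) privacy_threshold E n ^+ 2.

Definition coalition_utility (R : realType) (M N L : nat)
    (E : edge_system R M N L) (alpha Xi : R) (m : 'I_M) (S : {set 'I_N})
    (z : partition_strategy E) (V : {set 'I_L}) : R :=
  (- alpha * (\sum_(n in S) delay m S z V n)
   + Xi * (\sum_(n in S) (privacy_threshold E n - privacy_loss z n))
   - Theta E) / #|S|%:R.

Definition deployment_problem (R : realType) (M N L : nat)
    (E : edge_system R M N L) (alpha Xi : R) (m : 'I_M) (S : {set 'I_N})
    (z : partition_strategy E) : set_max_problem R 'I_L :=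
  {| objective := coalition_utility alpha Xi m S z;
     feasible := fun V => \sum_(l in V) model_size E l <= srv_storage E m |}.

(* Main.v *)
(* The deployed set V enters the utility only through the indicators
   [l_n \in V] in the cloud-to-edge download delays, and it enters affinely.
   Hence the marginal gain of a new model j does not depend on V: the utility
   is modular, and submodularity holds with equality. *)
Require Import Defs.
From mathcomp Require Import all_boot all_order all_algebra.
From mathcomp Require Import reals exp.
From mathcomp Require Import ring.

Set Implicit Arguments.
Unset Strict Implicit.
Unset Printing Implicit Defensive.

Import Order.TTheory GRing.Theory Num.Theory.
Local Open Scope ring_scope.

(** The coefficient of the indicator [l \in V] in the [delay] of a device requesting [l]. *)
Definition download_delay (R : realType) (M N L : nat)
    (E : edge_system R M N L) (m : 'I_M) (l : 'I_L) : R :=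
  (1 - (prev_deployed E m l)%:R) * (model_size E l / cloud_rate E m).

(** As [j \notin V], adding [j] raises the indicator from 0 to 1 exactly for devices requesting [j];
    the other terms of [delay] stay fixed. *)
Lemma delay_setU1 (R : realType) (M N L : nat) (E : edge_system R M N L)
    (m : 'I_M) (S : {set 'I_N}) (z : partition_strategy E) (V : {set 'I_L})
    (j : 'I_L) (n : 'I_N) : j \notin V ->
  delay m S z (V :|: [set j]) n =
  delay m S z V n + (requested E n == j)%:R * download_delay E m j.
Proof.
move=> jV; rewrite /delay /download_delay in_setU in_set1.
case: eqP => [->|_]; last by rewrite orbF mul0r addr0.
by rewrite (negbTE jV) /=; ring.
Qed.

(** The privacy sum and [Theta] cancel in the difference, as do the old delays, so [V] is absent
    from the right-hand side. *)
Lemma coalition_utility_marginal (R : realType) (M N L : nat)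
    (E : edge_system R M N L) (alpha Xi : R) (m : 'I_M) (S : {set 'I_N})
    (z : partition_strategy E) (V : {set 'I_L}) (j : 'I_L) : j \notin V ->
  coalition_utility alpha Xi m S z (V :|: [set j])
    - coalition_utility alpha Xi m S z V =
  - alpha * (\sum_(n in S) (requested E n == j)%:R * download_delay E m j)
    / #|S|%:R.
Proof.
move=> jV; rewrite /coalition_utility -mulrBl.
rewrite (eq_bigr _ (fun n _ => delay_setU1 m S z n jV)) big_split /=.
by congr (_ / _); ring.
Qed.

Theorem theorem2 (R : realType) (M N L : nat) (E : edge_system R M N L)
    (alpha Xi : R) (alpha_gt0 : 0 < alpha) (Xi_ge0 : 0 <= Xi)
    (m : 'I_M) (S : {set 'I_N}) (S_neq0 : S != set0)
    (z : partition_strategy E) :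
  submodular_maximization (deployment_problem alpha Xi m S z).
Proof.
move=> A B j sAB jB /=.
have jA : j \notin A by apply: contra jB; apply: (subsetP sAB).
by rewrite !coalition_utility_marginal.
Qed.
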